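(* Let $I$ be a set, $\mathcal{F}$ a filter on $I$, and $\kappa$ an uncountable cardinal. Then the following statements are equivalent. (a) For every partition of $I$ into $<\kappa$ subsets $J_s$ ($s\in S$), there exist finitely many indices $s_0,\dots,s_{n-1}\in S$ such that $J_{s_0}\cup\dots\cup J_{s_{n-1}}\in\mathcal{F}$. (b) $\mathcal{F}$ is the intersection of finitely many $\kappa$-complete ultrafilters on $I$.
   Context: A filter on a set $I$ is a set $\mathcal{F}$ of subsets of $I$ such that $I\in\mathcal{F}$; if $J\in\mathcal{F}$ and $J\subseteq K\subseteq I$ then $K\in\mathcal{F}$; and if $J,K\in\mathcal{F}$ then $J\cap K\in\mathcal{F}$. A filter may be improper (i.e., equal to the set of all subsets of $I$). A filter is $\kappa$-complete, for $\kappa$ an infinite cardinal, if it is closed under intersections of families of $<\kappa$ members. An ultrafilter is a maximal proper filter. Convention: the intersection of the empty family of ultrafilters is the set of all subsets of $I$ (the improper filter), and ''finitely many'' allows zero. A partition of a set means an expression of it as the union of an indexed family of pairwise disjoint subsets, which are not required to be nonempty; ''into $<\kappa$ subsets'' means that the index set $S$ has cardinality $<\kappa$. *)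

(* Defs.v *)
From mathcomp Require Import all_boot.
From mathcomp Require Import boolp classical_sets functions cardinality filter.

Set Implicit Arguments.
Unset Strict Implicit.
Unset Printing Implicit Defensive.

Local Open Scope classical_set_scope.
Local Open Scope card_scope.

(* A cardinal is represented by a type of that cardinality. *)
Definition card_lt (S K : Type) : Prop :=
  [set: S] #<= [set: K] /\ ~ ([set: K] #<= [set: S]).

(* Unlike [partition] of classical_sets, the blocks may be empty. *)
Definition family_partition (I S : Type) (J : S -> set I) : Prop :=
  cover [set: S] J = [set: I] /\ trivIset [set: S] J.

Definition card_complete (K I : Type) (F : set_system I) : Prop :=
  forall (S : Type) (A : S -> set I), card_lt S K ->
    (forall s, F (A s)) -> F (\bigcap_(s in [set: S]) A s).

(* Main.v *)
(* For a set A, let F|A = within A F be the filter generated by F and A. If A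
   is not a finite union of sets B with F|B an ultrafilter, then A splits as
   B and A \ B with B of the same kind and A \ B not negligible for F.
   Starting from I and iterating gives infinitely many disjoint non-negligible
   sets, hence a countable partition violating (a). So F is an intersection of
   finitely many ultrafilters F|B. Each of them is complete: if X_s is in F|B
   for all s, send a point outside the intersection of the X_s to some s with
   x not in X_s; finitely many fibers of this map cover a set of F, and on it
   the finitely many corresponding X_s meet only inside the intersection. *)
Require Import Defs.
From mathcomp Require Import all_boot.
From mathcomp Require Import boolp classical_sets functions cardinality filter.

Local Open Scope classical_set_scope.
Local Open Scope card_scope.

Lemma fiber_partition (I S : Type) (c : I -> S) :
  family_partition (fun s => c @^-1` [set s]).
Proof.
split; first by rewrite -subTset => x _; exists (c x).
by move=> s t _ _ [x [/= <- <-]].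
Qed.

Lemma card_lt_nat_uncountable (K : Type) :
  ~ countable [set: K] -> card_lt nat K.
Proof.
move=> Kunc; split=> //; apply/infiniteP => /finite_set_countable.
exact: Kunc.
Qed.

Lemma filter_bigcap_fin (I : Type) (T : finType) (F : set_system I)
    (A : T -> set I) :
  Filter F -> (forall i, F (A i)) -> F (\bigcap_(i in [set: T]) A i).
Proof.
move=> FF FA; apply: filterS (filter_forall (f := A) FF FA) => x Ax i _.
exact: Ax.
Qed.

(** A proper filter finer than [U] with a member outside [U] would also contain its complement,
    hence [set0]. *)
Lemma setVsetC_ultra (I : Type) (U : set_system I) : ProperFilter U ->
  (forall A, U A \/ U (~` A)) -> UltraFilter U.
Proof.
move=> UP UVC; split=> // G GP UG; rewrite eqEsubset; split=> // A GA.
case: (UVC A) => // /UG GAC; exfalso; apply: (@filter_not_empty _ G).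
by rewrite -(setICr A); exact: filterI.
Qed.

Lemma within_setU (I : Type) (F : set_system I) (A B : set I) : Filter F ->
  within (A `|` B) F = within A F `&` within B F.
Proof.
move=> FF; rewrite eqEsubset; split=> P.
  by move=> FP; split; apply: (filterS (F := F)) FP => x /= ABP ?; apply: ABP;
    [left | right].
by move=> [FA FB]; apply: (filterS2 (F := F)) FA FB => x /= AP BP [/AP|/BP].
Qed.

Section UltraDecomposable.
Variables (I : Type) (F : set_system I).
Context {FF : Filter F}.

(** Comparing filters instead of sets ignores negligible differences; [n = 0] covers negligible [A],
    where [within A F] is improper. *)
Definition ultra_decomposable (A : set I) : Prop :=
  exists (n : nat) (B : 'I_n -> set I),
    (forall i, UltraFilter (within (B i) F)) /\
    within A F = \bigcap_(i in [set: 'I_n]) within (B i) F.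

Lemma ultra_decomposableU (A B : set I) :
  ultra_decomposable A -> ultra_decomposable B ->
  ultra_decomposable (A `|` B).
Proof.
move=> [m [C [Cu AE]]] [n [D [Du BE]]].
exists (m + n)%N, (fun i =>
  match fintype.split i with inl j => C j | inr k => D k end).
split; first by move=> i; case: (fintype.split i).
rewrite within_setU AE BE eqEsubset; split=> P.
  by move=> [PC PD] i _; case: (fintype.split i) => j; [exact: PC | exact: PD].
move=> PCD; split=> j _.
  by have := PCD (lshift n j) Logic.I; rewrite (unsplitK (inl j)).
by have := PCD (rshift m j) Logic.I; rewrite (unsplitK (inr j)).
Qed.

Lemma ultra_decomposable_negligible (A : set I) :
  F (~` A) -> ultra_decomposable A.
Proof.
move=> FnA; exists 0%N, (fun=> A); split; first by case.
rewrite eqEsubset; split=> P _; first by case.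
by apply: (filterS (F := F)) FnA => x nAx /nAx.
Qed.

Lemma ultra_decomposable1 (A : set I) :
  UltraFilter (within A F) -> ultra_decomposable A.
Proof.
move=> uA; exists 1%N, (fun=> A); split=> //.
by rewrite bigcap_const //; exists ord0.
Qed.

(** Since [within A F] is proper but not ultra, some [B] splits [A] into two non-negligible pieces.
    They cannot both be decomposable, as their union is [A]; a non-decomposable one is kept. *)
Lemma not_ultra_decomposable_split (A : set I) : ~ ultra_decomposable A ->
  exists B, [/\ B `<=` A, ~ ultra_decomposable B & ~ F (~` (A `\` B))].
Proof.
move=> nA.
have properA : ProperFilter (within A F).
  split; last exact: within_filter.
  by move=> FA0; apply: nA; exact: ultra_decomposable_negligible FA0.
have [B [nB nBC]] : exists B, ~ within A F B /\ ~ within A F (~` B).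
  apply: contrapT => /forallNP h; apply: nA; apply: ultra_decomposable1.
  apply: setVsetC_ultra => B.
  by apply: contrapT => /not_orP; exact: h.
have [dAB|] := pselect (ultra_decomposable (A `&` B)).
  exists (A `\` B); split; first exact: subDsetl.
    move=> dAD; apply: nA; rewrite -(setUIDK A B).
    exact: ultra_decomposableU.
  move=> h; apply: nBC; apply: (filterS (F := F)) h => x /= h Ax Bx.
  by apply: h; split=> // -[].
exists (A `&` B); split=> //.
move=> h; apply: nB; apply: (filterS (F := F)) h => x /= h Ax.
by apply: contrapT => nBx; apply: h; split=> // -[].
Qed.

Lemma ultra_decomposableT :
  (forall c : I -> nat, exists n (s : 'I_n -> nat),
     F (\bigcup_(i in [set: 'I_n]) c @^-1` [set s i])) ->
  ultra_decomposable setT.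
Proof.
move=> Fc; apply: contrapT => nT.
have /choice[f fP] : forall A, exists B, ~ ultra_decomposable A ->
    [/\ B `<=` A, ~ ultra_decomposable B & ~ F (~` (A `\` B))].
  move=> A; have [dA|/not_ultra_decomposable_split[B ?]] :=
    pselect (ultra_decomposable A); by [exists A | exists B].
pose A n := iter n f setT.
have nA n : ~ ultra_decomposable (A n) by elim: n => //= n /fP[].
have subA m n : (m <= n)%N -> A n `<=` A m.
  move=> /subnK <-; elim: (n - m)%N => [|k IH]; first by rewrite add0n.
  by rewrite addSn; apply: subset_trans IH; have [] := fP _ (nA (k + m)%N).
(* Sends a point of a difference [A n \ A n.+1] to its index [n]; points in no difference get the
   default 0. *)
pose c x := xget 0%N [set n | (A n `\` A n.+1) x].
have cE n x : (A n `\` A n.+1) x -> c x = n.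
  move=> Dx; apply: xget_unique => // m Dmx.
  apply/eqP; rewrite eqn_leq; apply/andP; split; rewrite leqNgt; apply/negP.
    by move=> /subA/(_ _ Dmx.1); exact: Dx.2.
  by move=> /subA/(_ _ Dx.1); exact: Dmx.2.
have [n [s Fs]] := Fc c.
(* This index exceeds every [s i], so the corresponding difference misses all the chosen fibers and
   would be negligible. *)
have [_ _] := fP _ (nA (\max_(i < n) s i).+1); apply.
apply: filterS Fs => x [i _ /= cx] Dx; have := cE (\max_(i < n) s i).+1 x Dx.
by rewrite cx => sE; have := @leq_bigmax 'I_n s i; rewrite sE ltnn.
Qed.

End UltraDecomposable.

Lemma ultra_card_complete (I K : Type) (F U : set_system I) :
  UltraFilter U -> F `<=` U ->
  (forall (S : Type) (c : I -> S), card_lt S K ->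
     exists n (s : 'I_n -> S),
       F (\bigcup_(i in [set: 'I_n]) c @^-1` [set s i])) ->
  card_complete K U.
Proof.
move=> uU FU Fc S X SK UX; have UF : Filter U by exact: filter_filter.
set Y := \bigcap_(s in _) X s.
(* With [S] empty no map [I -> S] need exist, but the intersection is then all of [I]. *)
have [s0|S0] := pselect (exists s : S, True); last first.
  by apply: filterE => x s _; exfalso; apply: S0; exists s.
have /choice[c cP] : forall x, exists s, ~ Y x -> ~ X s x.
  move=> x; have [Yx|/existsNP[s /not_implyP[_ nXs]]] := pselect (Y x).
    by case: s0 => s _; exists s.
  by exists s.
have [n [s /FU Us]] := Fc S c SK.
have UXs := filter_bigcap_fin _ _ _ (X \o s) UF (fun i => UX (s i)).
apply: filterS2 Us UXs => x [i _ /= cx] Xx.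
by apply: contrapT => /cP; rewrite cx; apply; exact: Xx.
Qed.

(** Otherwise all complements of blocks lie in [U], and by completeness so does their intersection,
    which is empty. *)
Lemma ultra_partition (I K S : Type) (U : set_system I) (J : S -> set I) :
  UltraFilter U -> card_complete K U -> card_lt S K -> family_partition J ->
  exists s, U (J s).
Proof.
move=> uU KU SK [cJ _]; apply: contrapT => /forallNP nUJ.
apply: (@filter_not_empty _ U).
rewrite -setCT -cJ /cover setC_bigcup; apply: KU => // s.
by have [/nUJ|] := in_ultra_setVsetC (J s) uU.
Qed.

Theorem lemma4 (I : Type) (F : set_system I) (FF : Filter F)
    (K : Type) (K_uncountable : ~ countable [set: K]) :
  (forall (S : Type) (J : S -> set I),
      card_lt S K -> family_partition J ->
      exists (n : nat) (s : 'I_n -> S),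
        F (\bigcup_(i in [set: 'I_n]) J (s i)))
  <->
  (exists (n : nat) (U : 'I_n -> set_system I),
      (forall i, UltraFilter (U i) /\ card_complete K (U i)) /\
      F = \bigcap_(i in [set: 'I_n]) U i).
Proof.
split=> [Fpart | [n [U [uU FE]]] S J SK Jpart].
  (* Fibers of maps to [nat] yield the finite decomposition; fibers of maps to general [S] yield
     completeness. *)
  have Ffib (S : Type) (c : I -> S) (SK : card_lt S K) :=
    Fpart S _ SK (fiber_partition I S c).
  have Fnat (c : I -> nat) :=
    Ffib nat c (card_lt_nat_uncountable K K_uncountable).
  have [n [B [uB FE]]] := ultra_decomposableT _ _ Fnat.
  exists n, (fun i => within (B i) F); split; last by rewrite -FE withinET.
  move=> i; split=> //; apply: ultra_card_complete Ffib => //.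
  exact: cvg_within.
have /choice[s Us] : forall i, exists s, U i (J s).
  by move=> i; have [ui Ki] := uU i; exact: ultra_partition Ki SK Jpart.
(* One block per ultrafilter suffices: the union contains a member of each [U i]. *)
exists n, s; rewrite FE => i _.
have [ui _] := uU i; apply: filterS (Us i) => x Jx.
by exists i.
Qed.
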